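(* Let $G$ and $K$ be topological groups, let $X$ and $Y$ be Hausdorff $G$-spaces and $Z$ a Hausdorff $K$-space, and let $$G\ltimes Y\xleftarrow{\,m\ltimes\epsilon\,}K\ltimes Z\xrightarrow{\,n\ltimes\phi\,}G\ltimes X$$ be a generalized map (so $m\ltimes\epsilon$ is an essential equivalence and $n\ltimes \phi$ is an equivariant map). If the homomorphisms $m,n:K\to G$ are naturally conjugate (with respect to the action of $K$ on $Z$), then the generalized map is equivalent to a $G$-map by a natural transformation: there exists a $G$-map $\varphi:Y\to X$ such that the equivariant maps $(\mathrm{id}_G\ltimes\varphi)\circ(m\ltimes\epsilon)$ and $n\ltimes\phi$ from $K\ltimes Z$ to $G\ltimes X$ are related by a natural transformation.
   Context: **Translation groupoids.** For a topological group $G$ acting continuously on a Hausdorff space $X$, the translation groupoid $G\ltimes X$ has space of objects $X$ and space of arrows $G\times X$, where $(g,x)$ is an arrow from $x$ to $gx$, with composition induced by multiplication in $G$. An *equivariant map* $m\ltimes\epsilon: K\ltimes Z\to G\ltimes X$ consists of a (continuous) group homomorphism $m:K\to G$ and a continuous map $\epsilon:Z\to X$ with $\epsilon(kz)=m(k)\epsilon(z)$ for all $k\in K$, $z\in Z$. A *$G$-map* $f:Y\to X$ between $G$-spaces is a continuous map with $f(gy)=gf(y)$; it gives the equivariant map $\mathrm{id}_G\ltimes f$. **Natural transformations.** For equivariant maps $m\ltimes\phi,\ n\ltimes\psi: K\ltimes Z\to G\ltimes X$, a natural transformation from $\phi$ to $\psi$ is a continuous map $\lambda:Z\to G$ with $\lambda(z)\phi(z)=\psi(z)$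 and $n(k)\lambda(z)=\lambda(kz)m(k)$ for all $k\in K,z\in Z$. **Essential equivalences.** An equivariant map $m\ltimes\epsilon:K\ltimes Z\to H\ltimes Y$ is an essential equivalence if (1) the map $H\times Z\to Y$, $(h,z)\mapsto h\epsilon(z)$, is an open surjection; and (2) the map $K\times Z\to \{((h,y),(z,z'))\in (H\times Y)\times(Z\times Z) : y=\epsilon(z),\ hy=\epsilon(z')\}$ given by $(k,z)\mapsto((m(k),\epsilon(z)),(z,kz))$ is a homeomorphism. **Generalized maps.** A generalized map from $H\ltimes Y$ to $G\ltimes X$ is a diagram $H\ltimes Y\xleftarrow{\,m\ltimes\epsilon\,}K\ltimes Z\xrightarrow{\,n\ltimes\phi\,}G\ltimes X$ of equivariant maps with $m\ltimes\epsilon$ an essential equivalence. **Naturally conjugate homomorphisms.** If $K$ acts on $Z$, two homomorphisms $m,n:K\to G$ are naturally conjugate if there exists a continuous function $\lambda:Z\to G$ such that $n(k)=\lambda(kz)\,m(k)\,\lambda(z)^{-1}$ for every $k\in K$ and $z\in Z$. *)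

(* Defs.v *)
From HB Require Import structures.
From mathcomp Require Import all_boot all_classical.
From mathcomp Require Import topology.

Set Implicit Arguments.
Unset Strict Implicit.
Unset Printing Implicit Defensive.

Local Open Scope classical_set_scope.
Local Open Scope group_scope.

(* No separation axiom is imposed on topological groups. *)
HB.mixin Record isTopologicalGroup G of Topological G & Group G := {
  mulg_continuous : continuous (fun p : G * G => p.1 * p.2);
  invg_continuous : continuous (fun g : G => g^-1)
}.

#[short(type="topologicalGroupType")]
HB.structure Definition TopologicalGroup :=
  {G of Topological G & Group G & isTopologicalGroup G}.

(* Left actions; the Hausdorff condition on the space is kept separate. *)
HB.mixin Record isGSpace (G : topologicalGroupType) X of Topological X := {
  gact : G -> X -> X;
  gact1 : forall x, gact 1 x = x;
  gactM : forall g h x, gact (g * h) x = gact g (gact h x);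
  gact_continuous : continuous (fun p : G * X => gact p.1 p.2)
}.

#[short(type="gspaceType")]
HB.structure Definition GSpace (G : topologicalGroupType) :=
  {X of Topological X & isGSpace G X}.

Definition homeomorphism (S T : topologicalType) (f : S -> T) : Prop :=
  continuous f /\
  exists g : T -> S, [/\ continuous g, cancel f g & cancel g f].

(* [eqv_map K H Z Y] is the type of equivariant maps from the translation
   groupoid of K acting on Z to that of H acting on Y. *)
Record eqv_map (K H : topologicalGroupType) (Z : gspaceType K)
    (Y : gspaceType H) := EqvMap {
  eqv_hom : {multiplicative K -> H};
  eqv_fun : Z -> Y;
  eqv_hom_continuous : continuous eqv_hom;
  eqv_fun_continuous : continuous eqv_fun;
  eqv_funE : forall k z, eqv_fun (gact k z) = gact (eqv_hom k) (eqv_fun z)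
}.

Record gmap (G : topologicalGroupType) (Y X : gspaceType G) := GMap {
  gmap_fun :> Y -> X;
  gmap_continuous : continuous gmap_fun;
  gmap_act : forall g y, gmap_fun (gact g y) = gact g (gmap_fun y)
}.

Section Composition.
Context (K H G : topologicalGroupType).
Context (Z : gspaceType K) (Y : gspaceType H) (X : gspaceType G).
Context (f : eqv_map Y X) (e : eqv_map Z Y).

Fact eqv_comp_hom_continuous : continuous (eqv_hom f \o eqv_hom e).
Proof.
by move=> k; apply: continuous_comp; [exact: eqv_hom_continuous|
  exact: eqv_hom_continuous].
Qed.

Fact eqv_comp_fun_continuous : continuous (eqv_fun f \o eqv_fun e).
Proof.
by move=> z; apply: continuous_comp; [exact: eqv_fun_continuous|
  exact: eqv_fun_continuous].
Qed.

Fact eqv_comp_funE k z : (eqv_fun f \o eqv_fun e) (gact k z) =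
  gact ((eqv_hom f \o eqv_hom e) k) ((eqv_fun f \o eqv_fun e) z).
Proof. by rewrite /= !eqv_funE. Qed.

Definition eqv_comp : eqv_map Z X :=
  @EqvMap K G Z X (eqv_hom f \o eqv_hom e : {multiplicative K -> G})
    (eqv_fun f \o eqv_fun e)
    eqv_comp_hom_continuous eqv_comp_fun_continuous eqv_comp_funE.

End Composition.

Fact idfun_continuous (T : topologicalType) : continuous (@idfun T).
Proof. by move=> x. Qed.

Definition eqv_of_gmap (G : topologicalGroupType) (Y X : gspaceType G)
    (f : gmap Y X) : eqv_map Y X :=
  @EqvMap G G Y X (@idfun G : {multiplicative G -> G}) f
    (@idfun_continuous G) (@gmap_continuous G Y X f) (@gmap_act G Y X f).

(* [lambda] is a natural transformation from [f1] to [f2]. *)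
Definition natural_transformation (K G : topologicalGroupType)
    (Z : gspaceType K) (X : gspaceType G) (f1 f2 : eqv_map Z X)
    (lambda : Z -> G) : Prop :=
  [/\ continuous lambda,
      forall z, gact (lambda z) (eqv_fun f1 z) = eqv_fun f2 z &
      forall k z,
        eqv_hom f2 k * lambda z = lambda (gact k z) * eqv_hom f1 k].

Definition naturally_conjugate (K G : topologicalGroupType)
    (Z : gspaceType K) (m n : {multiplicative K -> G}) : Prop :=
  exists2 lambda : Z -> G, continuous lambda &
    forall k z, n k = lambda (gact k z) * m k * (lambda z)^-1.

Section EssentialEquivalence.
Context (K H : topologicalGroupType) (Z : gspaceType K) (Y : gspaceType H).
Context (e : eqv_map Z Y).

Definition ess_translate (p : H * Z) : Y := gact p.1 (eqv_fun e p.2).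

Definition ess_pullback : set ((H * Y) * (Z * Z)) :=
  [set q | q.1.2 = eqv_fun e q.2.1 /\ gact q.1.1 q.1.2 = eqv_fun e q.2.2].

Definition ess_arrow (p : K * Z) : (H * Y) * (Z * Z) :=
  ((eqv_hom e p.1, eqv_fun e p.2), (p.2, gact p.1 p.2)).

Fact ess_arrow_pullback p : ess_arrow p \in ess_pullback.
Proof. by apply/mem_set; split => //=; rewrite eqv_funE. Qed.

(* The codomain is [set_type ess_pullback], with the subspace topology of the
   product. *)
Definition ess_compare (p : K * Z) : ess_pullback :=
  exist _ (ess_arrow p) (ess_arrow_pullback p).

Definition essential_equivalence : Prop :=
  [/\ forall A : set (H * Z), open A -> open (ess_translate @` A),
      set_surj setT setT ess_translate &
      homeomorphism ess_compare].

End EssentialEquivalence.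

(* Main.v *)
(**
  Let [lambda] conjugate [m] into [n]. The map
  [(g, z) |-> g (lambda z)^-1 phi(z)] on [G * Z] is constant on the fibres of
  the open surjection [(g, z) |-> g epsilon(z)]: by full faithfulness, two
  points of a fibre differ by some [k] in [K], and the conjugacy relation
  cancels it. Hence it descends to a [G]-map [Y -> X], and [lambda] itself is
  the natural transformation.
*)
Require Import Defs.
From HB Require Import structures.
From mathcomp Require Import all_boot all_classical.
From mathcomp Require Import topology.

Set Implicit Arguments.
Unset Strict Implicit.
Unset Printing Implicit Defensive.

Local Open Scope classical_set_scope.
Local Open Scope group_scope.

Lemma open_surj_factor (S T U : topologicalType) (t : S -> T) (F : S -> U) :
    (forall A : set S, open A -> open (t @` A)) -> set_surj setT setT t ->
    continuous F -> (forall s s', t s = t s' -> F s = F s') ->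
  exists2 phi : T -> U, continuous phi & forall s, phi (t s) = F s.
Proof.
move=> t_open t_surj /continuousP F_cont F_fibre.
(* The section [r] need not be continuous; the fibre condition makes [F \o r] independent of its
   choice. *)
have /choice[r rK] y : exists s, t s = y by have [s _ <-] := t_surj y I; exists s.
have phiE s : F (r (t s)) = F s by apply: F_fibre; rewrite rK.
exists (F \o r) => //; apply/continuousP => A A_open.
suff -> : (F \o r) @^-1` A = t @` (F @^-1` A) by exact/t_open/F_cont.
apply/seteqP; split=> [y Ay | _ [s As <-]]; first by exists (r y).
by rewrite /preimage /= phiE.
Qed.

(** The element [g'^-1 * g] carries [eqv_fun e z] to [eqv_fun e z'], hence gives a point of the
    pullback, which the inverse of [ess_compare] lifts to an arrow of [K]. *)
Lemma ess_translate_fibre (K H : topologicalGroupType) (Z : gspaceType K)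
    (Y : gspaceType H) (e : eqv_map Z Y) (g g' : H) (z z' : Z) :
    essential_equivalence e ->
    ess_translate e (g, z) = ess_translate e (g', z') ->
  exists2 k, gact k z = z' & g = g' * eqv_hom e k.
Proof.
move=> [_ _ [_ [c [_ _ cK]]]]; rewrite /ess_translate /= => tE.
have qP : ((g'^-1 * g, eqv_fun e z), (z, z')) \in ess_pullback e.
  by apply/mem_set; split=> //=; rewrite gactM tE -gactM mulVg gact1.
pose q : ess_pullback e := SigSub qP.
case: (c q) (congr1 val (cK q)) => k z1 /=.
by case=> kE _ -> <-; exists k => //; rewrite kE mulVKg.
Qed.

Theorem theorem5p3 (G K : topologicalGroupType)
    (X Y : gspaceType G) (Z : gspaceType K)
    (hausX : hausdorff_space X) (hausY : hausdorff_space Y)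
    (hausZ : hausdorff_space Z)
    (e : eqv_map Z Y) (f : eqv_map Z X)
    (ess_e : essential_equivalence e)
    (conj_ef : naturally_conjugate Z (eqv_hom e) (eqv_hom f)) :
  exists phi : gmap Y X, exists lambda : Z -> G,
    natural_transformation (eqv_comp (eqv_of_gmap phi) e) f lambda.
Proof.
have [lam lam_cont lamE] := conj_ef.
have [t_open t_surj _] := ess_e.
pose F (p : G * Z) : X := gact (p.1 * (lam p.2)^-1) (eqv_fun f p.2).
have F_cont : continuous F.
  move=> p; apply: (@continuous_comp _ _ _
    (fun p : G * Z => (p.1 * (lam p.2)^-1, eqv_fun f p.2))
    (fun q : G * X => gact q.1 q.2)); last exact: gact_continuous.
  apply: cvg_pair => /=; last first.
    by apply: continuous_comp; [exact: cvg_snd | exact: eqv_fun_continuous].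
  apply: (@continuous_comp _ _ _ (fun p : G * Z => (p.1, (lam p.2)^-1))
    (fun q : G * G => q.1 * q.2)); last exact: mulg_continuous.
  apply: cvg_pair => /=; first exact: cvg_fst.
  apply: (@continuous_comp _ _ _ (fun p : G * Z => lam p.2)
    (fun g : G => g^-1)); last exact: invg_continuous.
  by apply: continuous_comp; [exact: cvg_snd | exact: lam_cont].
have F_fibre p q : ess_translate e p = ess_translate e q -> F p = F q.
  case: p q => [g z] [g' z'] /(ess_translate_fibre ess_e)[k <- ->].
  (* Conjugacy gives [(lam (k z))^-1 * n k = m k * (lam z)^-1], with [m], [n] the homomorphisms of
     [e], [f]. *)
  by rewrite /F /= eqv_funE -gactM (lamE k z) !mulgA mulgVK.
have [phi phi_cont phiE] := open_surj_factor t_open t_surj F_cont F_fibre.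
have phi_act g y : phi (gact g y) = gact g (phi y).
  have [[h z] _ <-] := t_surj y I.
  have -> : gact g (ess_translate e (h, z)) = ess_translate e (g * h, z).
    by rewrite /ess_translate /= gactM.
  by rewrite !phiE /F /= !gactM.
exists (GMap phi_cont phi_act), lam; split=> // [z | k z] /=.
  (* Lifting [eqv_fun e z] to [(1, z)] gives [phi (eqv_fun e z)] as [(lam z)^-1] acting on
     [eqv_fun f z]. *)
  have -> : eqv_fun e z = ess_translate e (1, z) by rewrite /ess_translate gact1.
  by rewrite phiE /F /= mul1g -gactM mulgV gact1.
by rewrite (lamE k z) mulgVK.
Qed.
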